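(* Let $A$ be an $\omega^\phi$-Archimedean initial subgroup of $\mathbf{No}$. Then $K$ is a nontrivial initial convex subgroup of $A$ if and only if $K=A[\omega^\tau]$ for some additively indecomposable infinite ordinal $\omega^\tau\le\omega^\phi$.
   Context: The underlying set theory is NBG with global choice; structures may have proper-class universes. $\mathbf{No}$ is Conway's ordered field of surreal numbers, with its tree structure: a surreal number is identified with a sequence of signs $-,+$ indexed by an ordinal; $x<_s y$ (''$x$ is simpler than $y$'', ''$x$ is a predecessor of $y$'') means that $x$ is a proper initial segment of $y$; and $<$ is the lexicographic order determined by $-<\text{undefined}<+$. Addition and multiplication are Conway's. A subclass $A\subseteq\mathbf{No}$ is initial if $x\in A$ and $y<_s x$ imply $y\in A$; an initial subgroup is an additive subgroup that is initial. The class $\mathbf{On}$ of ordinals is identified with the class of surreals all of whose signs are $+$. For a nontrivial initial subgroup $A$ of $\mathbf{No}$, $\mathbf{On}(A)=\mathbf{On}\cap A$ is an initial segment of $\mathbf{On}$, and $A$ is called $\alpha$-Archimedean if $\alpha$ is the height of the tree $\mathbf{On}(A)$, i.e. $\mathbf{On}(A)=\{\beta\in\mathbf{On}:\beta<\alpha\}$; here $\alpha=\mathbf{On}$ is allowed, with the convention $\omega^{\mathbf{On}}=\mathbf{On}$ (so $\phi$ is a nonzero ordinal or $\phi=\mathbf{On}$, and $\tau=\phi$ is allowed also in the case $\phi=\mathbf{On}$). It is known that every nontrivial initial subgroup is $\omega^\phi$-Archimedean for some such $\phi$. An ordinal is additively indecomposable if it has the form $\omega^\tau$ (ordinal exponentiation);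 it is infinite iff $\tau\neq0$. For nonzero $\tau\le\phi$, $$A[\omega^\tau]=\{x\in A: -\alpha<x<\alpha\text{ for some ordinal }\alpha<\omega^\tau\}.$$ A subgroup $K$ of $A$ is convex if $x<z<y$ with $x,y\in K$, $z\in A$ implies $z\in K$. *)

(* Defs.v *)
From HB Require Import structures.
From mathcomp Require Import all_boot all_order generic_quotient.
From mathcomp Require Import boolp classical_sets.

Set Implicit Arguments.
Unset Strict Implicit.
Unset Printing Implicit Defensive.

Import Order.TTheory.

Local Open Scope order_scope.
Local Open Scope classical_set_scope.
Local Open Scope quotient_scope.

(** The universe of the index types [X] plays the role of the class of sets:
    [Ord] and [No] below live one universe higher, and their subclasses are the
    predicates [set Ord] and [set No]. *)

(** [Node f] stands for the least ordinal greater than all the ordinals denoted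
    by the [f i]; every ordinal arises in this way, from many different trees.
    [tree_le] compares the denoted ordinals. *)
Inductive tree : Type := Node (X : Type) (f : X -> tree).

Fixpoint tree_le (s t : tree) : Prop :=
  match s, t with
  | Node X f, Node Y g => forall i : X, exists j : Y, tree_le (f i) (g j)
  end.

Definition tree_lt (s t : tree) : Prop :=
  match t with Node Y g => exists j : Y, tree_le s (g j) end.

Lemma tree_le_refl s : tree_le s s.
Proof. by elim: s => X f IH i; exists i; apply: IH. Qed.

Lemma tree_le_trans s t u : tree_le s t -> tree_le t u -> tree_le s u.
Proof.
elim: s t u => X f IH [Y g] [Z h] fg gh i.
by have [j ij] := fg i; have [k jk] := gh j; exists k; apply: IH ij jk.
Qed.

Lemma tree_ltW s t : tree_lt s t -> tree_le s t.
Proof.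
elim: s t => X f IH [Y g] [j fj] i; exists j; apply: IH.
by case: (g j) fj => Z h /(_ i).
Qed.

Lemma tree_lt_le_total s t : tree_lt s t \/ tree_le t s.
Proof.
elim: s t => X f IH [Y g].
have [|/existsNP[j /forallNP nle]] := pselect (tree_le (Node g) (Node f)).
  by right.
left; exists j; case E : (g j) => [Z h] i.
by have [|] := IH i (g j); [rewrite E|move/nle].
Qed.

HB.instance Definition _ := gen_eqMixin tree.
HB.instance Definition _ := gen_choiceMixin tree.

Definition tree_eq (s t : tree) : bool := `[< tree_le s t /\ tree_le t s >].

Lemma tree_eq_equiv : equiv_class_of tree_eq.
Proof.
split=> [s|s t|t s u].
- by apply/asboolP; split; apply: tree_le_refl.
- by apply/asboolP/asboolP => -[].
- move=> /asboolP[st ts] /asboolP[tu ut].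
  by apply/asboolP; split; [apply: tree_le_trans tu|apply: tree_le_trans ts].
Qed.

Canonical tree_equiv := EquivRelPack tree_eq_equiv.

Definition Ord : Type := {eq_quot tree_equiv}.
HB.instance Definition _ := Choice.on Ord.
HB.instance Definition _ := Quotient.on Ord.

Fact surreal_display : Order.disp_t. Proof. exact: (Order.Disp tt tt). Qed.

Definition ord_le (a b : Ord) : bool := `[< tree_le (repr a) (repr b) >].

Lemma ord_le_refl : reflexive ord_le.
Proof. by move=> a; apply/asboolP/tree_le_refl. Qed.

Lemma ord_le_anti : antisymmetric ord_le.
Proof.
move=> a b /andP[/asboolP ab /asboolP ba].
by rewrite -[a]reprK -[b]reprK; apply/eqmodP/asboolP.
Qed.

Lemma ord_le_trans : transitive ord_le.
Proof.
move=> b a c /asboolP ab /asboolP bc.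
by apply/asboolP; apply: tree_le_trans bc.
Qed.

Lemma ord_le_total : total ord_le.
Proof.
move=> a b; have [/tree_ltW|] := tree_lt_le_total (repr a) (repr b).
  by move=> ab; apply/orP; left; apply/asboolP.
by move=> ba; apply/orP; right; apply/asboolP.
Qed.

HB.instance Definition _ := Order.Le_isPOrder.Build surreal_display Ord
  ord_le_refl ord_le_anti ord_le_trans.
HB.instance Definition _ :=
  Order.POrder_isTotal.Build surreal_display Ord ord_le_total.

Lemma ord_lt_wf : well_founded (fun a b : Ord => a < b).
Proof.
suff acc t (a : Ord) : tree_le (repr a) t -> Acc (fun a b : Ord => a < b) a.
  by move=> a; apply: (acc (repr a)); apply: tree_le_refl.
elim: t a => Y g IH a at_; constructor=> b ba.
have : tree_lt (repr b) (repr a).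
  have [//|ab] := tree_lt_le_total (repr b) (repr a).
  by move: ba; rewrite ltNge => /negP[]; apply/asboolP.
case: (repr a) at_ => X f fg [i bi]; have [j ij] := fg i.
by apply: (IH j); apply: tree_le_trans ij.
Qed.

Definition Ord0 : Ord := \pi_Ord (Node (of_void tree)).

Definition least (P : set Ord) : Ord :=
  xget Ord0 [set a | P a /\ forall b, P b -> a <= b].

(** [omega] is the least nonzero limit ordinal. *)
Definition omega : Ord :=
  least [set c | Ord0 < c /\ forall a, a < c -> exists b, a < b /\ b < c].

(** The recursion clauses below treat zero, successor and limit stages
    uniformly, e.g. [a * b] is the supremum of the [a * d + a] for [d < b], and
    [omega ^ b] is the supremum of 1 and the [(omega ^ d) * omega], [d < b]. *)
Definition ord_add (a : Ord) : Ord -> Ord :=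
  Fix ord_lt_wf (fun _ => Ord) (fun b rec =>
    least [set c | a <= c /\ forall d (h : d < b), rec d h < c]).

Definition ord_mul (a : Ord) : Ord -> Ord :=
  Fix ord_lt_wf (fun _ => Ord) (fun b rec =>
    least [set c | forall d (h : d < b), ord_add (rec d h) a <= c]).

Definition omega_pow : Ord -> Ord :=
  Fix ord_lt_wf (fun _ => Ord) (fun b rec =>
    least [set c | Ord0 < c /\
                   forall d (h : d < b), ord_mul (rec d h) omega <= c]).

(** Ordinals together with the class [On] of all ordinals, encoded as
    [None]. *)
Definition Ord_On : Type := option Ord.

Definition below (p : Ord_On) : set Ord :=
  if p is Some a then [set b | b < a] else setT.

Definition Ord_On_le (p q : Ord_On) : Prop :=
  match p, q with
  | _, None => True
  | None, Some _ => False
  | Some a, Some b => a <= b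
  end.

(** With the convention [omega ^ On = On]. *)
Definition Ord_On_omega_pow (p : Ord_On) : Ord_On := omap omega_pow p.

(** Sign sequences: [Some true] is [+], [Some false] is [-], and [None] means
    undefined; the places at which [sign_at] is defined form an ordinal. *)
Record No := MkNo {
  sign_at :> Ord -> option bool;
  _ : exists a : Ord, forall b, sign_at b <-> b < a }.

HB.instance Definition _ := gen_eqMixin No.
HB.instance Definition _ := gen_choiceMixin No.

Lemma No_ext (x y : No) : (forall a, x a = y a) -> x = y.
Proof.
case: x y => [f Hf] [g Hg] /= fg.
have fgE : f = g by apply: funext.
by move: Hf Hg; rewrite fgE => Hf Hg; congr MkNo; apply: Prop_irrelevance.
Qed.

Definition sign_lt (s t : option bool) : bool :=
  match s, t with
  | Some false, None | Some false, Some true | None, Some true => true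
  | _, _ => false
  end.

Definition No_lt (x y : No) : bool :=
  `[< exists a, (forall b, b < a -> x b = y b) /\ sign_lt (x a) (y a) >].

Lemma No_lt_irr : irreflexive No_lt.
Proof. by move=> x; apply/asboolP => -[a [_]]; case: (x a) => [[]|]. Qed.

Lemma No_lt_trans : transitive No_lt.
Proof.
move=> y x z /asboolP[a [xy sxy]] /asboolP[b [yz syz]]; apply/asboolP.
have [ab|ba|ab] := ltgtP a b.
- exists a; rewrite -(yz _ ab); split=> // c ca.
  by rewrite xy // yz // (lt_trans ca).
- exists b; rewrite (xy _ ba); split=> // c cb.
  by rewrite xy ?yz // (lt_trans cb).
- exists a; split=> [c ca|]; first by rewrite xy ?yz // -ab.
  by move: sxy syz; rewrite -ab; case: (x a) (y a) (z a) => [[]|] [[]|] [[]|].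
Qed.

HB.instance Definition _ :=
  Order.Lt_isPOrder.Build surreal_display No No_lt_irr No_lt_trans.

Lemma No_le_total : total (<=%O : rel No).
Proof.
move=> x y; have [<-|nxy] := eqVneq x y; first by rewrite lexx.
have [a [xya nxya]] : exists a, (forall b, b < a -> x b = y b) /\ x a <> y a.
  apply: contrapT => /forallNP no; move/eqP: nxy; apply; apply: No_ext.
  elim/(well_founded_ind ord_lt_wf) => a IH.
  by apply: contrapT => nxya; apply: (no a).
have : sign_lt (x a) (y a) \/ sign_lt (y a) (x a).
  by case: (x a) (y a) nxya => [[]|] [[]|] nxya;
    (by left) || (by right) || case: nxya.
case=> s; apply/orP; [left|right]; apply: ltW; apply/asboolP; exists a.
  by [].
by split=> // b /xya.
Qed.

HB.instance Definition _ :=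
  Order.POrder_isTotal.Build surreal_display No No_le_total.

(** [simpler x y] is "x is a proper initial segment of y". *)
Definition simpler (x y : No) : Prop :=
  x <> y /\ forall a, x a -> x a = y a.

Lemma simpler_wf : well_founded simpler.
Proof.
suff acc a (x : No) : (forall b, x b <-> b < a) -> Acc simpler x.
  by move=> x; case: (x) (erefl x) => f [a fa] _; apply: (acc a).
elim/(well_founded_ind ord_lt_wf): a x => a IH x xa.
constructor=> y [nyx yx]; have [c yc] : exists c, forall b, y b <-> b < c.
  by case: (y).
apply: (IH c) => //; rewrite ltNge; apply/negP => ac.
apply: nyx; apply: No_ext => b.
case E : (y b) => [s|]; first by rewrite -yx ?E.
case F : (x b) => [s|] //.
have /xa ba : x b by rewrite F.
by have /yc : b < c by [exact: lt_le_trans ac]; rewrite E.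
Qed.

Lemma all_plus_domain (a : Ord) :
  exists c, forall b, (if b < a then Some true else None) <-> b < c.
Proof. by exists a => b; case: (b < a). Qed.

Definition No_of_ord (a : Ord) : No := MkNo (all_plus_domain a).

Definition No0 : No := No_of_ord Ord0.

(** [cut L R] is the simplest surreal lying strictly between [L] and [R]; it
    exists as soon as [L] and [R] are sets with [L < R]. *)
Definition cut (L R : set No) : No :=
  let between := [set z : No | (forall l, L l -> l < z) /\
                               (forall r, R r -> z < r)] in
  xget No0 [set z | between z /\ forall w, between w -> w = z \/ simpler z w].

(** [left_values x f] is the class of the values [f x^L], where [x^L] ranges
    over the left options of [x], i.e. the predecessors of [x] which are less
    than [x]; likewise for [right_values] and [x^R]. *)
Definition left_values (x : No) (f : forall y, simpler y x -> No) : set No :=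
  [set z | exists y (h : simpler y x), y < x /\ z = f y h].

Definition right_values (x : No) (f : forall y, simpler y x -> No) : set No :=
  [set z | exists y (h : simpler y x), x < y /\ z = f y h].

(** [- x = { - x^R | - x^L }] *)
Definition No_opp : No -> No :=
  Fix simpler_wf (fun _ => No) (fun x opp =>
    cut (right_values opp) (left_values opp)).

(** [x + y = { x^L + y, x + y^L | x^R + y, x + y^R }] *)
Definition No_add : No -> No -> No :=
  Fix simpler_wf (fun _ => No -> No) (fun x add_x' =>
    Fix simpler_wf (fun _ => No) (fun y add_x_y' =>
      cut (left_values (fun x' h => add_x' x' h y) `|` left_values add_x_y')
          (right_values (fun x' h => add_x' x' h y) `|` right_values add_x_y'))).

Definition initial (A : set No) : Prop :=
  forall x y, A x -> simpler y x -> A y.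

Definition subgroup (A : set No) : Prop :=
  [/\ A No0,
      forall x y, A x -> A y -> A (No_add x y) &
      forall x, A x -> A (No_opp x)].

Definition nontrivial (A : set No) : Prop := exists2 x, A x & x <> No0.

Definition convex_in (A K : set No) : Prop :=
  forall x y z, K x -> K y -> A z -> x < z -> z < y -> K z.

Definition archimedean (p : Ord_On) (A : set No) : Prop :=
  forall a : Ord, A (No_of_ord a) <-> below p a.

(** [A[p]], where [p] is an ordinal or [On]. *)
Definition bounded_part (A : set No) (p : Ord_On) : set No :=
  [set x | A x /\ exists a, below p a /\
                  No_opp (No_of_ord a) < x /\ x < No_of_ord a].

(* Main.v *)
Require Import Defs.
From mathcomp Require Import all_boot all_order boolp classical_sets.
From mathcomp Require Import generic_quotient.

(** An initial subgroup [K] contains the largest all-plus initial segment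
    [plus_prefix x] of each of its elements [x], and
    [x < plus_prefix x + 1]. Hence a convex [K] is determined by its ordinals.
    These form an initial segment of [On] closed under surreal addition, which
    restricts to the natural sum [nadd] on ordinals, and the ordinals closed
    under [nadd] are exactly the powers of [omega].

    Conversely, [A[omega ^ tau]] is closed under addition because
    [plus_prefix (x + y) <= nadd (plus_prefix x) (plus_prefix y)]: unless [x]
    is an ordinal, [plus_prefix x] is a right option of [x], so that
    [x + y < plus_prefix x + y], and similarly for [y]. Lower bounds follow from
    [-(x + y) = -x + -y]. Neither argument needs the cuts defining [x + y] to be
    nonempty: the junk value 0 of an empty cut satisfies both statements. *)

Set Implicit Arguments.
Unset Strict Implicit.
Unset Printing Implicit Defensive.

Import Order.TTheory.

Local Open Scope order_scope.
Local Open Scope classical_set_scope.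
Local Open Scope quotient_scope.

(** * Ordinals *)

Lemma least_spec (P : set Ord) :
  (exists c, P c) -> P (least P) /\ forall b, P b -> least P <= b.
Proof.
move=> [c Pc]; pose Q := [set a | P a /\ forall b, P b -> a <= b].
suff exQ : exists a, Q a by exact: (xgetPex Ord0 exQ).
elim/(well_founded_ind ord_lt_wf): c Pc => c IH Pc.
have [[b Pb bc]|nex] := pselect (exists2 b, P b & b < c); first exact: IH Pb.
exists c; split=> // b Pb.
by rewrite leNgt; apply/negP => bc; apply: nex; exists b.
Qed.

Lemma least_mem (P : set Ord) : (exists c, P c) -> P (least P).
Proof. by case/least_spec. Qed.

Lemma least_le (P : set Ord) c : P c -> least P <= c.
Proof. by move=> Pc; have [|_] := @least_spec P; [exists c|apply]. Qed.

Lemma lt_least (P : set Ord) c : c < least P -> ~ P c.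
Proof. by move=> cl /least_le; rewrite leNgt cl. Qed.

Lemma pi_le (s t : tree) : (\pi_Ord s <= \pi_Ord t) <-> tree_le s t.
Proof.
have piE u : tree_le (repr (\pi_Ord u)) u /\ tree_le u (repr (\pi_Ord u)).
  by have /eqmodP/asboolP := reprK (\pi_Ord u).
have [s1 s2] := piE s; have [t1 t2] := piE t.
split=> [/asboolP st|st].
  by apply: tree_le_trans t1; apply: tree_le_trans st.
by apply/asboolP; apply: tree_le_trans t2; apply: tree_le_trans st.
Qed.

Lemma Ord0_le a : Ord0 <= a.
Proof. by rewrite -[a]reprK; apply/pi_le; case: (repr a) => X f []. Qed.

(** Every ordinal below the one denoted by [t] is denoted by a subtree of [t],
    and the subtrees are indexed by a type of the same universe as the index
    types of [tree]; this yields [replacement]. *)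
Fixpoint subtree_index (t : tree) : Type :=
  let: Node X f := t in {i : X & option (subtree_index (f i))}.

Fixpoint subtree (t : tree) : subtree_index t -> tree :=
  match t with
  | Node X f => fun s => if tagged s is Some u then subtree u else f (tag s)
  end.

Lemma subtree_surj (t : tree) (a : Ord) :
  a < \pi_Ord t -> exists s : subtree_index t, a = \pi_Ord (subtree s).
Proof.
elim: t => X f IH; rewrite -[a]reprK => af.
have : tree_lt (repr a) (Node f).
  have [//|/pi_le] := tree_lt_le_total (repr a) (Node f).
  by rewrite leNgt af.
move=> [i /pi_le]; rewrite le_eqVlt => /orP[/eqP->|].
  by exists (existT _ i None).
by rewrite reprK => /IH[s ->]; exists (existT _ i (Some s)).
Qed.

Lemma family_bound (X : Type) (f : X -> tree) (i : X) :
  \pi_Ord (f i) < \pi_Ord (Node f).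
Proof.
rewrite ltNge; apply/negP => /pi_le; case E : (f i) => [Y g] le_fg.
have: tree_lt (f i) (f i) by rewrite {2}E; apply: le_fg.
elim: (f i) => Z h IH [j hj]; apply: (IH j).
by case: {-2}(h j) hj => W k /(_ j).
Qed.

(** The recursions for sums, products and powers take [least] of a class of upper bounds; this shows
    that the class is inhabited, so that [least] is not the default value. *)
Lemma replacement (f : Ord -> Ord) (b : Ord) :
  exists c, forall d, d < b -> f d < c.
Proof.
pose g (s : subtree_index (repr b)) := repr (f (\pi_Ord (subtree s))).
exists (\pi_Ord (Node g)) => d; rewrite -{1}[b]reprK => /subtree_surj[s ->].
by have := family_bound g s; rewrite reprK.
Qed.

Definition ord_succ (a : Ord) : Ord := least [set c | a < c].

Lemma lt_ord_succ a : a < ord_succ a.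
Proof.
apply: (least_mem (P := [set c | a < c])).
have := family_bound (fun _ : unit => repr a) tt.
by rewrite reprK; exists (\pi_Ord (Node (fun _ : unit => repr a))).
Qed.

Lemma ord_succ_le a b : (ord_succ a <= b) = (a < b).
Proof.
apply/idP/idP; last exact: least_le.
exact: lt_le_trans (lt_ord_succ a).
Qed.

Lemma lt_ord_succE a b : (a < ord_succ b) = (a <= b).
Proof. by rewrite ltNge ord_succ_le -leNgt. Qed.

(** * Recursion equations and ordinal arithmetic *)

Section Recursion.
Variables (T : Type) (R : T -> T -> Prop) (Rwf : well_founded R) (U : Type).

Lemma Fix_unfold (F : forall x, (forall y, R y x -> U) -> U) x :
  Fix Rwf (fun _ => U) F x = F x (fun y _ => Fix Rwf (fun _ => U) F y).
Proof.
apply: (Fix_eq Rwf (fun _ => U)) => {}x f g fg; congr (F x).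
by apply: functional_extensionality_dep => y; apply: funext => h.
Qed.

End Recursion.

Implicit Types (a b c d : Ord) (x y z : No).

Lemma ord_addE a b : ord_add a b =
  least [set c | a <= c /\ forall d, d < b -> ord_add a d < c].
Proof. by rewrite /ord_add Fix_unfold. Qed.

Lemma ord_add_mem a b :
  a <= ord_add a b /\ forall d, d < b -> ord_add a d < ord_add a b.
Proof.
rewrite ord_addE.
apply: (least_mem
  (P := [set c | a <= c /\ forall d, d < b -> ord_add a d < c])).
have [c bc] := replacement (ord_add a) b.
exists (Order.max a c); split=> [|d /bc dc]; first by rewrite le_max lexx.
by rewrite lt_max dc orbT.
Qed.

Lemma ord_le_addr a b : a <= ord_add a b.
Proof. by have [] := ord_add_mem a b. Qed.

Lemma ord_ltD2l a b d : d < b -> ord_add a d < ord_add a b.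
Proof. by have [_] := ord_add_mem a b; apply. Qed.

Lemma ord_add_le a b c :
  a <= c -> (forall d, d < b -> ord_add a d < c) -> ord_add a b <= c.
Proof. by move=> ac bc; rewrite ord_addE; apply: least_le. Qed.

Lemma lt_ord_add a b c : c < ord_add a b ->
  c < a \/ exists2 d, d < b & c <= ord_add a d.
Proof.
move=> cab; have [|ac] := ltP c a; [by left|right].
apply: contrapT => no; move: cab; rewrite ltNge => /negP; apply.
apply: ord_add_le => // d db; rewrite ltNge; apply/negP => cd.
by apply: no; exists d.
Qed.

Lemma ord_leD2r a b c : a <= b -> ord_add a c <= ord_add b c.
Proof.
move=> ab; elim/(well_founded_ind ord_lt_wf): c => c IH.
apply: ord_add_le => [|d dc]; first exact: le_trans (ord_le_addr b c).
exact: le_lt_trans (IH d dc) (ord_ltD2l b dc).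
Qed.

Lemma ord_le_addl a b : b <= ord_add a b.
Proof.
elim/(well_founded_ind ord_lt_wf): b => b IH; rewrite leNgt; apply/negP => ab.
by have := ord_ltD2l a ab; rewrite ltNge IH.
Qed.

Lemma ord_mul_spec a b :
  (forall d, d < b -> ord_add (ord_mul a d) a <= ord_mul a b) /\
  (forall c, (forall d, d < b -> ord_add (ord_mul a d) a <= c) ->
     ord_mul a b <= c).
Proof.
have mulE : ord_mul a b =
    least [set c | forall d, d < b -> ord_add (ord_mul a d) a <= c].
  by rewrite /ord_mul Fix_unfold.
split; rewrite mulE; last by move=> c bc; apply: least_le.
apply: (least_mem
  (P := [set c | forall d, d < b -> ord_add (ord_mul a d) a <= c])).
have [c bc] := replacement (fun d => ord_add (ord_mul a d) a) b.
by exists c => d /bc /ltW.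
Qed.

Lemma omega_pow_spec b :
  [/\ Ord0 < omega_pow b,
      forall d, d < b -> ord_mul (omega_pow d) omega <= omega_pow b &
      forall c, Ord0 < c ->
        (forall d, d < b -> ord_mul (omega_pow d) omega <= c) ->
        omega_pow b <= c].
Proof.
pose P := [set c | Ord0 < c /\
  forall d, d < b -> ord_mul (omega_pow d) omega <= c].
have powE : omega_pow b = least P by rewrite /omega_pow Fix_unfold.
have [pos ub] : P (least P).
  apply: least_mem.
  have [c bc] := replacement (fun d => ord_mul (omega_pow d) omega) b.
  exists (ord_succ c); split=> [|d /bc dc].
    exact: le_lt_trans (Ord0_le c) (lt_ord_succ c).
  exact: ltW (lt_trans dc (lt_ord_succ c)).
by split=> [|d|c c0 bc]; rewrite powE //; [exact: ub|exact: least_le].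
Qed.

(** Hessenberg's natural sum. *)
Definition nadd : Ord -> Ord -> Ord :=
  Fix ord_lt_wf (fun _ => Ord -> Ord) (fun a rec_a =>
    Fix ord_lt_wf (fun _ => Ord) (fun b rec_b =>
      least [set c | (forall d (h : d < a), rec_a d h b < c) /\
                     (forall d (h : d < b), rec_b d h < c)])).

Lemma naddE a b : nadd a b =
  least [set c | (forall d, d < a -> nadd d b < c) /\
                 (forall d, d < b -> nadd a d < c)].
Proof.
have E : nadd a = Fix ord_lt_wf (fun _ => Ord) (fun b rec_b =>
    least [set c | (forall d (h : d < a), nadd d b < c) /\
                   (forall d (h : d < b), rec_b d h < c)]).
  by rewrite /nadd Fix_unfold.
by rewrite {1}E Fix_unfold -E.
Qed.

Lemma nadd_mem a b : (forall d, d < a -> nadd d b < nadd a b) /\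
                   (forall d, d < b -> nadd a d < nadd a b).
Proof.
rewrite naddE.
apply: (least_mem (P := [set c | (forall d, d < a -> nadd d b < c) /\
                                 (forall d, d < b -> nadd a d < c)])).
have [c ac] := replacement (nadd^~ b) a; have [e be] := replacement (nadd a) b.
exists (Order.max c e).
by split=> d; [move/ac|move/be] => h; rewrite lt_max h ?orbT.
Qed.

Lemma nadd_ltl a b d : d < a -> nadd d b < nadd a b.
Proof. by have [+ _] := nadd_mem a b; apply. Qed.

Lemma nadd_ltr a b d : d < b -> nadd a d < nadd a b.
Proof. by have [_] := nadd_mem a b; apply. Qed.

Lemma nadd_le a b c : (forall d, d < a -> nadd d b < c) ->
  (forall d, d < b -> nadd a d < c) -> nadd a b <= c.
Proof. by move=> ac bc; rewrite naddE; apply: least_le. Qed.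

Lemma le_nadd a b c d : a <= c -> b <= d -> nadd a b <= nadd c d.
Proof.
move=> ac bd; apply: (@le_trans _ _ (nadd c b)).
  by move: ac; rewrite le_eqVlt => /orP[/eqP->//|/(nadd_ltl b)/ltW].
by move: bd; rewrite le_eqVlt => /orP[/eqP->//|/(nadd_ltr c)/ltW].
Qed.

(** [ord_add a] is the least strictly increasing function with values at least [a], and [nadd a] is
    another such function. *)
Lemma ord_add_le_nadd a b : ord_add a b <= nadd a b.
Proof.
elim/(well_founded_ind ord_lt_wf): b => b IH; apply: ord_add_le => [|d db].
  apply: (@le_trans _ _ (nadd a Ord0)); last exact: le_nadd (Ord0_le b).
  elim/(well_founded_ind ord_lt_wf): {IH} a => a IH.
  rewrite leNgt; apply/negP => na.
  by have := nadd_ltl Ord0 na; rewrite ltNge IH.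
exact: le_lt_trans (IH d db) (nadd_ltr a db).
Qed.

(** Turns closure under natural sums into closure under successors once 1 is available. *)
Lemma ord_succ_le_nadd a : ord_succ a <= nadd a (ord_succ Ord0).
Proof.
rewrite ord_succ_le; apply: lt_le_trans (ord_add_le_nadd _ _).
exact: le_lt_trans (ord_le_addr a Ord0) (ord_ltD2l a (lt_ord_succ _)).
Qed.

(** * Ordinals closed under the natural sum *)

Definition nadd_closed (c : Ord) : Prop :=
  Ord0 < c /\ forall a b, a < c -> b < c -> nadd a b < c.

Definition ord_of_nat (n : nat) : Ord := iter n ord_succ Ord0.

Lemma omega_mem :
  Ord0 < omega /\ forall a, a < omega -> exists b, a < b /\ b < omega.
Proof.
apply: (least_mem (P := [set c | Ord0 < c /\
  forall a, a < c -> exists b, a < b /\ b < c])).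
pose c := least [set c | forall n, ord_of_nat n < c].
have natc n : ord_of_nat n < c.
  apply: (least_mem (P := [set c | forall n, ord_of_nat n < c])).
  exists (\pi_Ord (Node (fun n => repr (ord_of_nat n)))) => {}n.
  by have := family_bound (fun n => repr (ord_of_nat n)) n; rewrite reprK.
exists c; split=> [|a ac]; first exact: natc 0%N.
have /existsNP[n /negP] : ~ (forall n, ord_of_nat n < a) := lt_least ac.
rewrite -leNgt => an; exists (ord_of_nat n.+1).
by split=> //; apply: le_lt_trans an (lt_ord_succ _).
Qed.

(** A nonzero limit exceeds every finite ordinal by induction. Conversely, the least strict bound of
    the finite ordinals is a nonzero limit, so [omega] is at most any ordinal above them all. *)
Lemma lt_omega a : a < omega <-> exists n, a <= ord_of_nat n.
Proof.
split=> [aw|[n an]]; last first.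
  apply: le_lt_trans an _; have [w0 wlim] := omega_mem.
  elim: n => //= n /wlim[b [nb bw]]; apply: le_lt_trans bw.
  by rewrite ord_succ_le.
pose P := [set c : Ord | forall n, ord_of_nat n < c].
apply: contrapT => /forallNP gt_nat; have {gt_nat}Pa : P a.
  by move=> n; rewrite ltNge; apply/negP/gt_nat.
move: aw; rewrite ltNge => /negP; apply; apply: le_trans (least_le Pa).
have natP : P (least P) by apply: least_mem; exists a.
apply: least_le; split=> [|d dP]; first exact: (natP 0%N).
have /existsNP[n /negP] : ~ P d := lt_least dP.
rewrite -leNgt => dn; exists (ord_of_nat n.+1).
by split=> //; apply: le_lt_trans dn (lt_ord_succ _).
Qed.

Definition ord_muln (g : Ord) (n : nat) : Ord :=
  iter n (fun a => ord_add a g) Ord0.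

Lemma le_ord_muln g m n : (m <= n)%N -> ord_muln g m <= ord_muln g n.
Proof.
elim: n => [|n IH]; first by rewrite leqn0 => /eqP->.
rewrite leq_eqVlt => /orP[/eqP->//|]; rewrite ltnS => /IH mn.
exact: le_trans mn (ord_le_addr _ _).
Qed.

Lemma ord_muln_le_mul_omega g n : ord_muln g n <= ord_mul g omega.
Proof.
have [ub _] := ord_mul_spec g omega.
case: n => [|n]; first exact: Ord0_le.
suff le_mul : ord_muln g n <= ord_mul g (ord_of_nat n).
  apply: le_trans (ord_leD2r _ le_mul) (ub _ _).
  by apply/lt_omega; exists n.
elim: n => [|n IH]; first exact: Ord0_le.
apply: le_trans (ord_leD2r _ IH) _.
by have [+ _] := ord_mul_spec g (ord_of_nat n.+1); apply; exact: lt_ord_succ.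
Qed.

(** Together with [ord_muln_le_mul_omega] this makes [ord_mul g omega] the supremum of the finite
    multiples of [g]. *)
Lemma lt_ord_mul_omega g a :
  a < ord_mul g omega -> exists n, a < ord_muln g n.
Proof.
move=> aw; apply: contrapT => /forallNP no.
move: aw; rewrite ltNge => /negP; apply.
have [_ ->//] := ord_mul_spec g omega => d /lt_omega[n dn].
have le_muln : ord_mul g d <= ord_muln g n.
  elim: n d dn => [|n IH] d dn.
    have [_] := ord_mul_spec g d; apply=> e ed.
    by have := lt_le_trans ed dn; rewrite ltNge Ord0_le.
  have [_] := ord_mul_spec g d; apply=> e ed.
  apply: ord_leD2r; apply: IH.
  by rewrite -lt_ord_succE; apply: lt_le_trans ed dn.
apply: le_trans (ord_leD2r _ le_muln) _.
by rewrite leNgt; apply/negP => /(no n.+1).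
Qed.

(** Division by [g] with remainder, as an inequality, which suffices for estimating natural sums. *)
Lemma lt_ord_muln g n a : a < ord_muln g n ->
  exists m r, [/\ (m < n)%N, r < g & a <= ord_add (ord_muln g m) r].
Proof.
elim: n => [|n IH]; first by rewrite /= ltNge Ord0_le.
case/lt_ord_add=> [/IH[m [r [mn rg ar]]]|[r rg ar]].
  by exists m, r; split=> //; apply: ltnW.
by exists n, r.
Qed.

(* For additively closed [g] this is the distributive law of the natural sum,
   with the remainders [r] and [s] kept track of so that the induction on
   [a] and [b] goes through. *)
Lemma nadd_muln_le g n m a b r s : nadd_closed g -> r < g -> s < g ->
  a <= ord_add (ord_muln g n) r -> b <= ord_add (ord_muln g m) s ->
  nadd a b <= ord_add (ord_muln g (n + m)) (nadd r s).
Proof.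
move=> [g0 gN].
elim/(well_founded_ind ord_lt_wf): a b n m r s => a IHa b.
elim/(well_founded_ind ord_lt_wf): b => b IHb n m r s rg sg ar bs.
have carry k l t : (k < l)%N -> t < g ->
    ord_add (ord_muln g k) t < ord_add (ord_muln g l) (nadd r s).
  move=> kl tg; apply: lt_le_trans (ord_le_addr _ _).
  exact: lt_le_trans (ord_ltD2l _ tg) (le_ord_muln g kl).
apply: nadd_le => d dlt.
(* Either a copy of [g] is lost, and [carry] absorbs the new remainder, or only the remainder
   drops. *)
- case: (lt_ord_add (lt_le_trans dlt ar)).
    move=> /lt_ord_muln[k [t [kn tg dt]]].
    apply: le_lt_trans (IHa d dlt b k m t s tg sg dt bs) _.
    by apply: carry; [rewrite ltn_add2r|exact: gN].
  move=> [t tr dt].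
  apply: le_lt_trans (IHa d dlt b n m t s (lt_trans tr rg) sg dt bs) _.
  by apply: ord_ltD2l; apply: nadd_ltl.
- case: (lt_ord_add (lt_le_trans dlt bs)).
    move=> /lt_ord_muln[k [t [kn tg dt]]].
    apply: le_lt_trans (IHb d dlt n k r t rg tg ar dt) _.
    by apply: carry; [rewrite ltn_add2l|exact: gN].
  move=> [t ts dt].
  apply: le_lt_trans (IHb d dlt n m r t rg (lt_trans ts sg) ar dt) _.
  by apply: ord_ltD2l; apply: nadd_ltr.
Qed.

Lemma lt_mul_omega g : Ord0 < g -> g < ord_mul g omega.
Proof.
move=> g0; apply: lt_le_trans (ord_muln_le_mul_omega g 2).
apply: le_lt_trans (ord_ltD2l _ g0).
exact: le_trans (ord_le_addl _ _) (ord_le_addr _ _).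
Qed.

Lemma nadd_closed_mul_omega g :
  nadd_closed g -> nadd_closed (ord_mul g omega).
Proof.
move=> gC; have [g0 gN] := gC.
split=> [|a b]; first exact: lt_trans (lt_mul_omega g0).
move=> /lt_ord_mul_omega[? /lt_ord_muln[n [r [_ rg ar]]]].
move=> /lt_ord_mul_omega[? /lt_ord_muln[m [s [_ sg bs]]]].
apply: le_lt_trans (nadd_muln_le gC rg sg ar bs) _.
(* The extra copy of [g] makes room for the remainder [nadd r s]. *)
apply: lt_le_trans (ord_muln_le_mul_omega g (n + m).+1).
exact/ord_ltD2l/gN.
Qed.

(** Ordinary sums are bounded by natural ones, so all finite multiples of [g] stay below [c]. *)
Lemma mul_omega_le g c : nadd_closed c -> g < c -> ord_mul g omega <= c.
Proof.
move=> [c0 cN] gc; rewrite leNgt; apply/negP => /lt_ord_mul_omega[n].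
rewrite ltNge => /negP; apply; apply: ltW.
elim: n => [//|n IH]; apply: le_lt_trans (ord_add_le_nadd _ _) _.
exact: cN.
Qed.

(** Minimality of [omega_pow t]. The case [a = 0] is excluded because no [d] exists when [t] is
    0. *)
Lemma lt_omega_pow t a : a < omega_pow t -> Ord0 < a ->
  exists2 d, d < t & a < ord_mul (omega_pow d) omega.
Proof.
move=> at_ a0; apply: contrapT => no; move: at_; rewrite ltNge => /negP.
apply; have [_ _ ->//] := omega_pow_spec t => d dt.
by rewrite leNgt; apply/negP => ad; apply: no; exists d.
Qed.

Lemma omega_pow_mul_omega d t :
  d < t -> ord_mul (omega_pow d) omega <= omega_pow t.
Proof. by have [_ + _] := omega_pow_spec t; apply. Qed.

Lemma omega_pow_gt0 t : Ord0 < omega_pow t.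
Proof. by have [] := omega_pow_spec t. Qed.

Lemma omega_pow0 : omega_pow Ord0 = ord_succ Ord0.
Proof.
apply/le_anti/andP; split; last by rewrite ord_succ_le omega_pow_gt0.
have [_ _] := omega_pow_spec Ord0; apply=> [|d]; first exact: lt_ord_succ.
by rewrite ltNge Ord0_le.
Qed.

Lemma omega_pow_lt d t : d < t -> omega_pow d < omega_pow t.
Proof.
move=> dt; apply: lt_le_trans (omega_pow_mul_omega dt).
exact/lt_mul_omega/omega_pow_gt0.
Qed.

Lemma le_omega_pow t : t <= omega_pow t.
Proof.
elim/(well_founded_ind ord_lt_wf): t => t IH; rewrite leNgt; apply/negP => tt.
by have := omega_pow_lt tt; rewrite ltNge IH.
Qed.

(** For nonzero [t], two ordinals below [omega_pow t] lie below a common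
    [ord_mul (omega_pow m) omega] with [m < t], which is closed by the induction hypothesis for
    [m]. *)
Lemma omega_pow_nadd_closed t : nadd_closed (omega_pow t).
Proof.
elim/(well_founded_ind ord_lt_wf): t => t IH.
split=> [|a b at_ bt]; first exact: omega_pow_gt0.
have [t0|t0] := leP t Ord0.
  have t0E : t = Ord0 by apply/le_anti; rewrite t0 Ord0_le.
  move: at_ bt; rewrite t0E omega_pow0 !lt_ord_succE => a0 b0.
  by apply: nadd_le => d dlt;
    [have := lt_le_trans dlt a0|have := lt_le_trans dlt b0];
    rewrite ltNge Ord0_le.
have bound c : c < omega_pow t ->
    exists2 d, d < t & c < ord_mul (omega_pow d) omega.
  move=> ct; have [c0|] := ltP Ord0 c; first exact: lt_omega_pow.
  move=> c0; exists Ord0 => //; apply: le_lt_trans c0 _.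
  exact: lt_trans (omega_pow_gt0 _) (lt_mul_omega (omega_pow_gt0 _)).
have mono d e : d <= e ->
    ord_mul (omega_pow d) omega <= ord_mul (omega_pow e) omega.
  rewrite le_eqVlt => /orP[/eqP->//|de].
  apply: le_trans (omega_pow_mul_omega de) _.
  exact/ltW/lt_mul_omega/omega_pow_gt0.
have [d dt ad] := bound a at_; have [e et be] := bound b bt.
have mt : Order.max d e < t by rewrite gt_max dt.
apply: lt_le_trans (omega_pow_mul_omega mt).
have [_] := nadd_closed_mul_omega (IH _ mt); apply.
  by apply: lt_le_trans ad (mono _ _ _); rewrite le_max lexx.
by apply: lt_le_trans be (mono _ _ _); rewrite le_max lexx orbT.
Qed.

(** Let [t] be least with [c <= omega_pow t]. A strict inequality would put [c] below
    [ord_mul (omega_pow d) omega] for some [d < t]; but [omega_pow d < c] by minimality, and closure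
    of [c] bounds that product by [c]. *)
Lemma nadd_closed_omega_pow c :
  nadd_closed c -> exists t, c = omega_pow t.
Proof.
move=> cC; have [c0 _] := cC.
pose P := [set t | c <= omega_pow t]; exists (least P).
have Pl : P (least P).
  by apply: least_mem; exists c; apply: le_omega_pow.
apply/le_anti/andP; split=> //.
rewrite leNgt; apply/negP => /lt_omega_pow[]// d dP.
rewrite ltNge => /negP; apply; apply: mul_omega_le => //.
by rewrite ltNge; apply/negP/(lt_least dP).
Qed.

(** * Surreal numbers *)

Lemma sign_dom (x : No) a b : x b -> a <= b -> x a.
Proof.
by case: x => f [c fc] /= /fc bc ab; apply/fc; apply: le_lt_trans ab bc.
Qed.

Lemma No_ltP (x y : No) :
  x < y <-> exists a, (forall b, b < a -> x b = y b) /\ sign_lt (x a) (y a).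
Proof. by split=> [/asboolP|] // h; apply/asboolP. Qed.

Definition prefix (x y : No) : Prop := forall a, x a -> x a = y a.

Lemma prefixE x y : prefix x y <-> y = x \/ simpler x y.
Proof.
split=> [xy|[->//|[]//]].
by have [->|nxy] := pselect (y = x); [left|right; split=> // /esym].
Qed.

Lemma prefix_anti x y : prefix x y -> prefix y x -> x = y.
Proof.
move=> xy yx; apply: No_ext => a; case E : (x a) => [s|].
  by rewrite -xy E.
by case F : (y a) => [s|//]; move: (yx a); rewrite F E => ->.
Qed.

Lemma trunc_subproof (x : No) a :
  exists c, forall b, (if b < a then x b else None) <-> b < c.
Proof.
case: x => f [c fc] /=; exists (Order.min a c) => b; rewrite lt_min.
by have [ba|ba] := ltP b a => //=; split.
Qed.

Definition trunc (x : No) a : No := MkNo (trunc_subproof x a).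

Lemma trunc_id (x : No) a : ~ x a -> trunc x a = x.
Proof.
move=> xa; apply: No_ext => b /=; have [//|ab] := ltP b a.
by case E : (x b) => [s|//]; case: xa; apply: sign_dom ab; rewrite E.
Qed.

Lemma trunc_simpler (x : No) a : x a -> simpler (trunc x a) x.
Proof.
move=> xa; split=> [xE|b /=]; last by case: (b < a).
by move: xa; rewrite -{1}xE /= ltxx.
Qed.

Lemma trunc_prefix (x : No) a : prefix (trunc x a) x.
Proof. by move=> b /=; case: (b < a). Qed.

Lemma simplerP x y : simpler x y -> exists2 a, y a & x = trunc y a.
Proof.
move=> [nxy xy]; have [a xa] : exists a, forall b, x b <-> b < a by case: (x).
exists a.
  apply: contrapT => ya; apply: nxy; apply: prefix_anti => // b yb.
  have /xa/xy -> // : b < a.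
  by rewrite ltNge; apply/negP => ab; apply: ya; apply: sign_dom ab.
apply: No_ext => b /=; have [/xa/xy//|ab] := ltP b a.
by case E : (x b) => [s|//]; have /xa : x b; rewrite ?E // ltNge ab.
Qed.

(** Recovers a sign of [v] from an inequality: the first difference between [trunc x a] and [v]
    cannot come before [a], where they agree, nor after [a], since then both would be undefined at
    [a]. *)
Lemma agree_trunc_lt (x v : No) a : (forall b, b < a -> x b = v b) ->
  trunc x a < v <-> v a = Some true.
Proof.
move=> xv; split=> [/No_ltP[b [agree]]|va]; last first.
  by apply/No_ltP; exists a; rewrite /= ltxx va; split=> // b ba; rewrite ba xv.
rewrite /=; case: ltgtP => [ba|ab|<-]; last by case: (v b) => [[]|].
  by rewrite xv //; case: (v b) => [[]|].
case E : (v b) => [[]|] // _; have := agree a ab; rewrite /= ltxx => va.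
by have : v a; [apply: (sign_dom _ (ltW ab)); rewrite E|rewrite -va].
Qed.

Lemma agree_trunc_gt (x v : No) a : (forall b, b < a -> x b = v b) ->
  v < trunc x a <-> v a = Some false.
Proof.
move=> xv; split=> [/No_ltP[b [agree]]|va]; last first.
  by apply/No_ltP; exists a; rewrite /= ltxx va; split=> // b ba; rewrite ba xv.
rewrite /=; case: ltgtP => [ba|ab|<-]; last by case: (v b) => [[]|].
  by rewrite xv //; case: (v b) => [[]|].
case E : (v b) => [[]|] // _; have := agree a ab; rewrite /= ltxx => va.
by have : v a; [apply: (sign_dom _ (ltW ab)); rewrite E|rewrite va].
Qed.

(** * Cuts, sign reversal and negation *)

Definition between (L R : set No) (z : No) : Prop :=
  (forall l, L l -> l < z) /\ (forall r, R r -> z < r).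

Lemma cut_eq (L R : set No) z :
  between L R z -> (forall w, between L R w -> prefix z w) -> cut L R = z.
Proof.
move=> zLR zmin; apply: xget_unique => [|y [yLR ymin]].
  by split=> // w /zmin/prefixE.
by apply: prefix_anti; [apply/prefixE/ymin|apply: zmin].
Qed.

(** Lets results on cuts be proved without constructing a simplest element: the other case is the
    default value 0. *)
Lemma cut_cases (L R : set No) :
  (between L R (cut L R) /\ forall w, between L R w -> prefix (cut L R) w) \/
  cut L R = No0 /\
  ~ exists2 z, between L R z & forall w, between L R w -> prefix z w.
Proof.
rewrite /cut; case: xgetP => [z -> [zLR zmin]|no]; [left|right].
  by split=> // w wLR; apply/prefixE/zmin.
split=> // -[z zLR zmin]; apply: (no z); split=> // w wLR.
exact/prefixE/zmin.
Qed.

Lemma flip_subproof (x : No) :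
  exists c, forall b, omap negb (x b) <-> b < c.
Proof. by case: x => f [c fc] /=; exists c => b; rewrite -fc; case: (f b). Qed.

Definition flip (x : No) : No := MkNo (flip_subproof x).

Lemma flipK : involutive flip.
Proof. by move=> x; apply: No_ext => a /=; case: (x a) => [[]|]. Qed.

Lemma prefix_flip x y : prefix x y -> prefix (flip x) (flip y).
Proof.
by move=> xy a /= xa; rewrite xy //; case: (x a) xa.
Qed.

Lemma simpler_flip x y : simpler x y -> simpler (flip x) (flip y).
Proof.
by move=> [nxy xy]; split; [move/(can_inj flipK)|exact: prefix_flip].
Qed.

Lemma lt_flip x y : (flip x < flip y) = (y < x).
Proof.
have flip_lt u v : u < v -> flip v < flip u.
  move=> /No_ltP[a [uv s]]; apply/No_ltP; exists a; split=> [b ba|/=].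
    by rewrite /= uv.
  by case: (u a) (v a) s => [[]|] [[]|].
by apply/idP/idP => [/flip_lt|/flip_lt//]; rewrite !flipK.
Qed.

Lemma flip0 : flip No0 = No0.
Proof. by apply: No_ext => a /=; rewrite ltNge Ord0_le. Qed.

Lemma between_flip (L R : set No) z :
  between L R z -> between (flip @` R) (flip @` L) (flip z).
Proof.
by move=> [Lz zR]; split=> _ [y + <-]; rewrite lt_flip; [exact: zR|exact: Lz].
Qed.

(** [flip] reverses the order and preserves initial segments, so it carries simplest elements to
    simplest elements. Being an involution that fixes 0, it also matches the default values. *)
Lemma flip_cut (L R : set No) : flip (cut L R) = cut (flip @` R) (flip @` L).
Proof.
have flipKK (A : set No) : flip @` (flip @` A) = A.
  by rewrite image_comp -[RHS]image_id; congr image; apply/funext/flipK.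
have flip_min U V z : (forall w, between U V w -> prefix z w) ->
    forall w, between (flip @` V) (flip @` U) w -> prefix (flip z) w.
  move=> zmin w /between_flip; rewrite !flipKK => /zmin/prefix_flip.
  by rewrite flipK.
have [[cLR cmin]|[-> no]] := cut_cases L R.
  by rewrite (cut_eq (between_flip cLR) (flip_min _ _ _ cmin)).
have [[cLR cmin]|[-> _]] := cut_cases (flip @` R) (flip @` L);
  last exact: flip0.
case: no; exists (flip (cut (flip @` R) (flip @` L))).
  by have := between_flip cLR; rewrite !flipKK.
by have := flip_min _ _ _ cmin; rewrite !flipKK.
Qed.

(** Every [w] in the cut extends [flip x]: for each place [a] of [x], the predecessor [trunc x a] is
    an option of [x], and the side on which it lies determines the sign of [w] at [a]. *)
Lemma No_oppE x : No_opp x = flip x.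
Proof.
elim/(well_founded_ind simpler_wf): x => x IH.
rewrite /No_opp Fix_unfold -/No_opp; apply: cut_eq => [|w [Lw wR]].
  by split=> _ [y [yx [xy ->]]]; rewrite IH // lt_flip.
rewrite -[w]flipK; apply: prefix_flip => a.
elim/(well_founded_ind ord_lt_wf): a => a IHa xa.
have agree b : b < a -> x b = flip w b.
  by move=> ba; apply: IHa => //; apply: sign_dom xa (ltW ba).
case E : (x a) xa => [[]|//] _; apply/esym.
- apply/(agree_trunc_lt agree); rewrite -[trunc x a]flipK lt_flip.
  have tx : simpler (trunc x a) x by apply: trunc_simpler; rewrite E.
  by apply: wR; exists (trunc x a), tx; rewrite IH //; split=> //;
    apply/agree_trunc_lt.
- apply/(agree_trunc_gt agree); rewrite -[trunc x a]flipK lt_flip.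
  have tx : simpler (trunc x a) x by apply: trunc_simpler; rewrite E.
  by apply: Lw; exists (trunc x a), tx; rewrite IH //; split=> //;
    apply/agree_trunc_gt.
Qed.

(** * Addition in terms of options *)

Definition left_options x : set No := [set y | simpler y x /\ y < x].
Definition right_options x : set No := [set y | simpler y x /\ x < y].

Definition add_left x y : set No :=
  No_add^~ y @` left_options x `|` No_add x @` left_options y.

Definition add_right x y : set No :=
  No_add^~ y @` right_options x `|` No_add x @` right_options y.

Lemma left_valuesE x (f : No -> No) :
  left_values (fun y (_ : simpler y x) => f y) = f @` left_options x.
Proof.
by apply/seteqP; split=> z; [move=> [y [yx [lt ->]]]|move=> [y [yx lt] <-]];
  exists y => //; exists yx.
Qed.

Lemma right_valuesE x (f : No -> No) :
  right_values (fun y (_ : simpler y x) => f y) = f @` right_options x.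
Proof.
by apply/seteqP; split=> z; [move=> [y [yx [lt ->]]]|move=> [y [yx lt] <-]];
  exists y => //; exists yx.
Qed.

Lemma No_addE x y : No_add x y = cut (add_left x y) (add_right x y).
Proof.
have E : No_add x = Fix simpler_wf (fun _ => No) (fun y add_x_y' =>
    cut (left_values (fun x' (_ : simpler x' x) => No_add x' y) `|`
         left_values add_x_y')
        (right_values (fun x' (_ : simpler x' x) => No_add x' y) `|`
         right_values add_x_y')).
  by rewrite /No_add Fix_unfold.
rewrite {1}E Fix_unfold -E.
rewrite (left_valuesE _ (No_add^~ y)) (right_valuesE _ (No_add^~ y)).
by rewrite (left_valuesE _ (No_add x)) (right_valuesE _ (No_add x)).
Qed.

Lemma right_options_flip x : right_options (flip x) = flip @` left_options x.
Proof.
apply/seteqP; split=> y.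
  move=> [yx xy]; exists (flip y); last exact: flipK.
  by split; [rewrite -[x]flipK; apply: simpler_flip|rewrite -lt_flip flipK].
by move=> [u [ux lt] <-]; split; [apply: simpler_flip|rewrite lt_flip].
Qed.

Lemma left_options_flip x : left_options (flip x) = flip @` right_options x.
Proof.
rewrite -[x in RHS]flipK right_options_flip image_comp -[LHS]image_id.
by congr image; apply/funext => y /=; rewrite flipK.
Qed.

(** Sign reversal exchanges left and right options, and by [flip_cut] it passes through every cut,
    filled or not. *)
Lemma add_flip x y : flip (No_add x y) = No_add (flip x) (flip y).
Proof.
elim/(well_founded_ind simpler_wf): x y => x IHx y.
elim/(well_founded_ind simpler_wf): y => y IHy.
rewrite !No_addE flip_cut /add_left /add_right !image_setU.
rewrite !left_options_flip !right_options_flip !image_comp.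
by congr (cut (_ `|` _) (_ `|` _)); apply: eq_imagel => u [us _];
  [exact: IHx|exact: IHy|exact: IHx|exact: IHy].
Qed.

(** * All-plus prefixes and comparison with ordinals *)

Definition plus_prefix (x : No) : Ord := least [set a | x a <> Some true].

Lemma plus_prefix_lt x a : a < plus_prefix x -> x a = Some true.
Proof. by move=> /lt_least/contrapT. Qed.

Lemma plus_prefix_neq (x : No) : x (plus_prefix x) <> Some true.
Proof.
apply: (least_mem (P := [set a | x a <> Some true])).
have [c xc] : exists c, forall b, x b <-> b < c by case: (x).
by exists c => /= xcT; have /xc : x c by [rewrite xcT]; rewrite ltxx.
Qed.

Lemma trunc_ord x a : a <= plus_prefix x -> trunc x a = No_of_ord a.
Proof.
move=> ax; apply: No_ext => b /=; case: ifP => // ba.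
exact/plus_prefix_lt/(lt_le_trans ba).
Qed.

Lemma prefix_ord x a : a <= plus_prefix x -> prefix (No_of_ord a) x.
Proof. by move=> /trunc_ord <-; apply: trunc_prefix. Qed.

Lemma No_of_ord_lt a b : a < b -> No_of_ord a < No_of_ord b.
Proof.
move=> ab; apply/No_ltP; exists a; rewrite /= ltxx ab; split=> // c ca.
by rewrite ca (lt_trans ca ab).
Qed.

Lemma lt_plus_prefix x :
  No_of_ord (plus_prefix x) = x \/
  x < No_of_ord (plus_prefix x) /\ simpler (No_of_ord (plus_prefix x)) x.
Proof.
rewrite -(trunc_ord (lexx (plus_prefix x))); have := @plus_prefix_neq x.
case E : (x _) => [[]|] // _; [right|by left; apply: trunc_id; rewrite E].
by split; [apply/agree_trunc_gt|apply: trunc_simpler; rewrite E].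
Qed.

(** If [a < plus_prefix x], then [a] is a truncation of [x] followed by a plus; otherwise
    [x <= plus_prefix x <= a]. *)
Lemma lt_No_of_ord a x : (No_of_ord a < x) = (a < plus_prefix x).
Proof.
apply/idP/idP => [|ax]; last first.
  by rewrite -(trunc_ord (ltW ax)); apply/agree_trunc_lt/plus_prefix_lt.
apply: contraTT; rewrite -!leNgt => xa.
have x_le : x <= No_of_ord (plus_prefix x).
  by have [->|[/ltW]] := lt_plus_prefix x.
apply: le_trans x_le _; move: xa; rewrite le_eqVlt => /orP[/eqP->//|].
by move=> /No_of_ord_lt/ltW.
Qed.

Lemma le_No_of_ord a x : (x <= No_of_ord a) = (plus_prefix x <= a).
Proof. by rewrite leNgt lt_No_of_ord -leNgt. Qed.

Lemma simpler_ordP x a :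
  simpler x (No_of_ord a) <-> exists2 b, b < a & x = No_of_ord b.
Proof.
split=> [/simplerP[b /= + ->]|[b ba ->]].
  case: ifP => // ba _; exists b => //.
  by apply: No_ext => c /=; case: ifP => // cb; rewrite (lt_trans cb ba).
split=> [E|c /=].
  by have := No_of_ord_lt ba; rewrite E ltxx.
by case: ifP => // cb; rewrite (lt_trans cb ba).
Qed.

(** The predecessors of an ordinal are the smaller ordinals, all of them left options, so the cut
    for the sum follows the recursion clause of [nadd]. *)
Lemma add_No_of_ord a b :
  No_add (No_of_ord a) (No_of_ord b) = No_of_ord (nadd a b).
Proof.
elim/(well_founded_ind ord_lt_wf): a b => a IHa b.
elim/(well_founded_ind ord_lt_wf): b => b IHb.
rewrite No_addE; apply: cut_eq => [|w [Lw _]].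
  split=> z [] [_ [/simpler_ordP[d dlt ->] cmp] <-].
  - by rewrite IHa //; apply/No_of_ord_lt/nadd_ltl.
  - by rewrite IHb //; apply/No_of_ord_lt/nadd_ltr.
  - by have := lt_trans cmp (No_of_ord_lt dlt); rewrite ltxx.
  - by have := lt_trans cmp (No_of_ord_lt dlt); rewrite ltxx.
(* Being above all left values, [w] begins with more pluses than each of them, hence with at least
   [nadd a b] pluses. *)
apply/prefix_ord/nadd_le => d dlt; rewrite -lt_No_of_ord; apply: Lw;
  [left|right].
- exists (No_of_ord d); last exact: IHa.
  by split; [apply/simpler_ordP; exists d|exact: No_of_ord_lt].
- exists (No_of_ord d); last exact: IHb.
  by split; [apply/simpler_ordP; exists d|exact: No_of_ord_lt].
Qed.

Lemma cut_le_ord (L R : set No) r c :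
  R r -> r <= No_of_ord c -> cut L R <= No_of_ord c.
Proof.
move=> Rr rc; have [[[_ +] _]|[-> _]] := cut_cases L R.
  by move=> /(_ r Rr)/ltW rcut; apply: le_trans rc.
(* The default value 0 is at most every ordinal. *)
rewrite le_No_of_ord; apply: least_le.
by rewrite /= ltNge Ord0_le.
Qed.

Lemma add_le_ord_l x y c :
  No_add (No_of_ord (plus_prefix x)) y <= No_of_ord c ->
  No_add x y <= No_of_ord c.
Proof.
have [->//|[xp px]] := lt_plus_prefix x; rewrite [No_add x y]No_addE.
by apply: cut_le_ord; left; exists (No_of_ord (plus_prefix x)).
Qed.

Lemma add_le_ord_r x y c :
  No_add x (No_of_ord (plus_prefix y)) <= No_of_ord c ->
  No_add x y <= No_of_ord c.
Proof.
have [->//|[yp py]] := lt_plus_prefix y; rewrite [No_add x y]No_addE.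
by apply: cut_le_ord; right; exists (No_of_ord (plus_prefix y)).
Qed.

Lemma plus_prefix_add x y :
  plus_prefix (No_add x y) <= nadd (plus_prefix x) (plus_prefix y).
Proof.
rewrite -le_No_of_ord; apply/add_le_ord_l/add_le_ord_r.
by rewrite add_No_of_ord.
Qed.

Lemma plus_prefix_le x y : prefix x y -> plus_prefix x <= plus_prefix y.
Proof.
move=> xy; rewrite leNgt; apply/negP => /plus_prefix_lt xT.
by apply: (plus_prefix_neq (x := y)); rewrite -xy xT.
Qed.

Lemma plus_prefix_ord a : plus_prefix (No_of_ord a) = a.
Proof.
apply/le_anti; rewrite -le_No_of_ord lexx leNgt; apply/negP => alt.
by apply: (plus_prefix_neq (x := No_of_ord a)); rewrite /= alt.
Qed.

(** * Initial subgroups and their convex subgroups *)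

Lemma initial_prefix A x y : initial A -> A x -> prefix y x -> A y.
Proof. by move=> Ai Ax /prefixE[<-//|]; apply: Ai. Qed.

Lemma initial_le_ord A a b :
  initial A -> A (No_of_ord a) -> b <= a -> A (No_of_ord b).
Proof.
by move=> Ai Aa ba; apply: initial_prefix Aa _ => //; apply: prefix_ord;
  rewrite plus_prefix_ord.
Qed.

(** A nonzero element or its negative starts with a plus, so 1 is one of its initial segments. *)
Lemma one_mem A : subgroup A -> initial A -> nontrivial A ->
  A (No_of_ord (ord_succ Ord0)).
Proof.
move=> [_ _ AN] Ai [x Ax x0].
have pos y : A y -> y (Ord0) = Some true -> A (No_of_ord (ord_succ Ord0)).
  move=> Ay yT; apply: initial_prefix Ay _ => //; apply: prefix_ord.
  rewrite ord_succ_le -lt_No_of_ord.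
  suff <- : trunc y Ord0 = No_of_ord Ord0.
    by apply/agree_trunc_lt => // b; rewrite ltNge Ord0_le.
  by apply: trunc_ord; apply: Ord0_le.
case E : (x Ord0) => [[]|]; first exact: pos Ax E.
  by apply: (pos (No_opp x)); [exact: AN|rewrite No_oppE /= E].
case: x0; rewrite -(@trunc_id x Ord0) ?E //.
by apply: trunc_ord; apply: Ord0_le.
Qed.

(** The two inequalities amount to bounds on the all-plus prefixes of [x] and [- x]; closure under
    successors turns these weak bounds into strict ones. *)
Lemma bounded_partP A p x : (forall a, below p a -> below p (ord_succ a)) ->
  (forall a b, below p b -> a <= b -> below p a) ->
  bounded_part A p x <->
  [/\ A x, below p (plus_prefix x) & below p (plus_prefix (flip x))].
Proof.
move=> pS ple; split=> [[Ax [a [pa [ax xa]]]]|[Ax px pfx]].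
  move: ax; rewrite No_oppE -[x in _ < x]flipK lt_flip => /ltW fxa.
  by move/ltW: xa => xa; split=> //; apply: ple pa _; rewrite -le_No_of_ord.
have lt_succ y b : plus_prefix y <= b -> y < No_of_ord (ord_succ b).
  move=> yb; apply: (@le_lt_trans _ _ (No_of_ord b)).
    by rewrite le_No_of_ord.
  exact/No_of_ord_lt/lt_ord_succ.
pose m := Order.max (plus_prefix x) (plus_prefix (flip x)).
split=> //; exists (ord_succ m).
split; first by apply: pS; rewrite /m; case: leP.
split; last by apply: lt_succ; rewrite le_max lexx.
rewrite No_oppE -[x in _ < x]flipK lt_flip.
by apply: lt_succ; rewrite le_max lexx orbT.
Qed.

(** Treats [omega_pow t] and [On] uniformly; a nonzero exponent puts 1 below the bound. *)
Lemma below_omega_pow tau : tau <> Some Ord0 ->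
  [/\ below (Ord_On_omega_pow tau) (ord_succ Ord0),
      forall a b, below (Ord_On_omega_pow tau) b -> a <= b ->
        below (Ord_On_omega_pow tau) a &
      forall a b, below (Ord_On_omega_pow tau) a ->
        below (Ord_On_omega_pow tau) b ->
        below (Ord_On_omega_pow tau) (nadd a b)].
Proof.
case: tau => [t|_]; last by split.
move=> t0; have {}t0 : Ord0 < t.
  by rewrite lt_neqAle Ord0_le andbT; apply/eqP => t0E; apply: t0; rewrite -t0E.
split=> /= [|a b bt ab|].
- by rewrite -omega_pow0; apply: omega_pow_lt.
- exact: le_lt_trans ab bt.
- by have [] := omega_pow_nadd_closed t.
Qed.

(** By [bounded_partP], each closure property reduces to an estimate of all-plus prefixes; the
    element 1 shows nontriviality. *)
Lemma bounded_part_convex_subgroup A tau : subgroup A -> initial A ->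
  nontrivial A -> tau <> Some Ord0 ->
  let K := bounded_part A (Ord_On_omega_pow tau) in
  [/\ K `<=` A, subgroup K, nontrivial K, initial K & convex_in A K].
Proof.
move=> As Ai An tau0; have [p1 ple padd] := below_omega_pow tau0.
have pS a : below (Ord_On_omega_pow tau) a ->
    below (Ord_On_omega_pow tau) (ord_succ a).
  by move=> pa; apply: ple (ord_succ_le_nadd a); apply: padd.
have p0 : below (Ord_On_omega_pow tau) Ord0 by apply: ple p1 (Ord0_le _).
have flip_ord a : plus_prefix (flip (No_of_ord a)) = Ord0.
  apply/le_anti; rewrite Ord0_le andbT; apply: least_le => /=.
  by case: (Ord0 < a).
have KP x := bounded_partP A x pS ple.
have [A0 AD AN] := As.
move=> K; split.
- by move=> x [].
- split=> [|x y /KP[Ax px pfx] /KP[Ay py pfy]|x /KP[Ax px pfx]]; apply/KP.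
  + by rewrite flip0 plus_prefix_ord.
  + split; first exact: AD.
      by apply: ple (plus_prefix_add x y); apply: padd.
    by rewrite add_flip; apply: ple (plus_prefix_add _ _); apply: padd.
  + by rewrite No_oppE flipK; split=> //; rewrite -No_oppE; apply: AN.
- exists (No_of_ord (ord_succ Ord0)).
    by apply/KP; rewrite plus_prefix_ord flip_ord; split=> //; apply: one_mem.
  move=> /(congr1 plus_prefix); rewrite !plus_prefix_ord => E.
  by have := lt_ord_succ Ord0; rewrite E ltxx.
- move=> x y /KP[Ax px pfx] yx; have [_ yxp] := yx; apply/KP; split.
  + exact: Ai yx.
  + exact: ple (plus_prefix_le yxp).
  + by apply: ple pfx _; apply/plus_prefix_le/prefix_flip.
- move=> x y z /KP[_ _ pfx] /KP[_ py _] Az xz zy; apply/KP; split=> //.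
  + apply: ple py _; rewrite -le_No_of_ord; apply: le_trans (ltW zy) _.
    by rewrite le_No_of_ord.
  + apply: ple pfx _; rewrite -le_No_of_ord.
    apply: (@le_trans _ _ (flip x)); first by rewrite ltW // lt_flip.
    by rewrite le_No_of_ord.
Qed.

(** The ordinals of [K] are all of [On], or those below the least missing one [c]. Addition in [K]
    makes [c] closed under [nadd], hence a power of [omega], and 1 in [K] rules out exponent 0. *)
Lemma initial_subgroup_archimedean K : subgroup K -> initial K ->
  nontrivial K ->
  exists2 tau, tau <> Some Ord0 & archimedean (Ord_On_omega_pow tau) K.
Proof.
move=> Ks Ki Kn; have K1 := one_mem Ks Ki Kn; have [K0 KD _] := Ks.
have [all_ord|/existsNP notK] := pselect (forall a, K (No_of_ord a)).
  by exists None.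
pose P := [set a | ~ K (No_of_ord a)]; pose c := least P.
have Kc a : K (No_of_ord a) <-> a < c.
  split=> [Ka|/lt_least/contrapT//]; rewrite ltNge; apply/negP => ca.
  have : P c by exact: least_mem notK.
  by apply; apply: initial_le_ord Ka ca.
have [t ct] : exists t, c = omega_pow t.
  apply: nadd_closed_omega_pow; split=> [|a b /Kc Ka /Kc Kb]; first exact/Kc.
  by apply/Kc; rewrite -add_No_of_ord; apply: KD.
exists (Some t) => [[t0]|a]; last by rewrite Kc ct.
by move/Kc: K1; rewrite ct t0 omega_pow0 ltxx.
Qed.

(** Initiality puts the all-plus prefixes of [x] and [- x] into [K], which bounds them; conversely,
    convexity captures whatever lies between [- a] and [a] for an ordinal [a] of [K]. *)
Lemma convex_subgroup_bounded_part A K tau : K `<=` A ->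
  subgroup K -> initial K -> convex_in A K -> tau <> Some Ord0 ->
  archimedean (Ord_On_omega_pow tau) K ->
  K = bounded_part A (Ord_On_omega_pow tau).
Proof.
move=> KA [_ _ KN] Ki Kconv tau0 Karch.
have [p1 ple padd] := below_omega_pow tau0.
apply/seteqP; split=> [x Kx|x [Ax [a [pa [ax xa]]]]]; last first.
  have Ka : K (No_of_ord a) by apply/Karch.
  exact: Kconv (KN _ Ka) Ka Ax ax xa.
have pK y : K y -> below (Ord_On_omega_pow tau) (plus_prefix y).
  move=> Ky; apply/Karch; apply: initial_prefix Ky _ => //.
  exact: prefix_ord.
apply/bounded_partP => //.
  by move=> a pa; apply: ple (ord_succ_le_nadd a); apply: padd.
by split; [exact: KA|exact: pK|apply: pK; rewrite -No_oppE; apply: KN].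
Qed.

Lemma archimedean_le A K p q : K `<=` A ->
  archimedean p A -> archimedean q K -> Ord_On_le q p.
Proof.
move=> KA Ap Kq; have qp a : below q a -> below p a.
  by move=> /Kq/KA/Ap.
case: p q qp {Ap Kq} => [a|] [b|] qp //=; last first.
  (* If [q] were [On] and [p] the ordinal [a], then [a] would lie below itself. *)
  by have := qp a I; rewrite /= ltxx.
by rewrite leNgt; apply/negP => /qp /=; rewrite ltxx.
Qed.

Theorem theorem4 (A : set No) (phi : Ord_On)
    (A_subgroup : subgroup A) (A_initial : initial A)
    (A_nontrivial : nontrivial A)
    (phi_neq0 : phi <> Some Ord0)
    (A_archimedean : archimedean (Ord_On_omega_pow phi) A)
    (K : set No) :
  [/\ K `<=` A, subgroup K, nontrivial K, initial K & convex_in A K] <->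
  exists tau : Ord_On,
    [/\ tau <> Some Ord0,
        Ord_On_le (Ord_On_omega_pow tau) (Ord_On_omega_pow phi) &
        K = bounded_part A (Ord_On_omega_pow tau)].
Proof.
split=> [[KA Ks Kn Ki Kconv]|[tau [tau0 _ ->]]]; last first.
  exact: bounded_part_convex_subgroup.
have [tau tau0 Karch] := initial_subgroup_archimedean Ks Ki Kn.
exists tau; split=> //; first exact: archimedean_le KA A_archimedean Karch.
exact: convex_subgroup_bounded_part.
Qed.
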